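(* Let $V$ be a finite acyclic digraph whose nodes are coloured white or gray, let $n\ge 0$, and let $G=(V,x)$ with $x$ a gray node of $V$ be such that all options of $G$ have been assigned by step $n$ of the labelling procedure described in the context. Let $\mathcal C_{n+1}(G)=\{k\in\mathbb Z_{0}^{+} : \mathrm{Cr}(G,k)=\textsc{true}\}$. Then $\mathcal C_{n+1}(G)$ is either finite, or infinite of the form $\mathbb Z_{0}^{+}\setminus F$ where $F$ is finite. Moreover: (1) If there is at least one option $G'=(V,x')$ of $G$ with $x'$ gray such that $\mathcal C_n(G')$ is infinite, let $\mathbb Z_0^{+}\setminus F_1,\ldots,\mathbb Z_0^{+}\setminus F_j$ be the infinite sets among the sets $\mathcal C_n(G')$ of the gray options $G'$ of $G$ (with $F_1,\dots,F_j$ finite), and let $l=\max(F_1\cup\cdots\cup F_j)$ (with the convention $\max\emptyset=-1$). Then $\mathrm{Cr}(G,k)=\textsc{false}$ for all $k>l$ (with $k\in\mathbb Z_0^+$). (2) Otherwise, let $l$ be the least nonnegative integer exceeding all integers in $$\bigcup_{G'=(V,x'),\ x'\text{ gray}}\mathcal C_n(G')\ \cup\ \{\mathcal G_n(G') : G'=(V,x'),\ x'\text{ white}\},$$ where $G'$ ranges over the options of $G$. Then $\mathrm{Cr}(G,k)=\textsc{true}$ for all $k\ge l$.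
   Context: $\mathbb Z_0^{+}$ denotes the nonnegative integers. A game is a pair $G=(V,x)$ where $V$ is a finite digraph with white and gray nodes and $x$ is a node of $V$ (the location of a piece). The options of $G$ are the games $G'=(V,x')$ with an arc from $x$ to $x'$; an option is called white or gray according to the colour of $x'$. A node is terminal if it has no outgoing arcs. $\mathrm{mex}(S)$ is the least nonnegative integer not in $S$. Function Cr. For an integer $k\ge 0$ and $G=(V,x)$ with $x$ gray and with all options already assigned by step $n$: if $x$ is terminal, $\mathrm{Cr}(G,k)=\textsc{true}$. If $x$ is not terminal, $\mathrm{Cr}(G,k)=\textsc{true}$ if every white option $G'$ of $G$ satisfies $\mathcal G_n(G')\neq k$ and every gray option $G'$ of $G$ satisfies $\mathrm{Cr}(G',k)=\textsc{false}$; otherwise $\mathrm{Cr}(G,k)=\textsc{false}$. Labelling procedure (acyclic impartial games with entailing moves). White nodes receive values $\mathcal G_n(G)\in\mathbb Z_0^+\cup\{\mathrm{Moon},\infty\}$, where $\mathrm{Moon}$ is a special non-integer symbol, and gray nodes receive values $\mathcal C_n(G)$ that are subsets of $\mathbb Z_0^+$ or the symbol $\infty$; $\infty$ means ''not assigned yet''. Step 0: $\mathcal G_0(G)=0$ if $x$ is white and terminal, $\mathcal G_0(G)=\infty$ if $x$ is white and not terminal; $\mathcal C_0(G)=\mathbb Z_0^+$ if $x$ is gray and terminal, $\mathcal C_0(G)=\infty$ if $x$ is gray and not terminal. Step $n+1$: if $x$ is white and all options of $G=(V,x)$ are assigned, let $D=\{\mathcal G_n(G'): G'\text{ white option}\}$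 and $P=\bigcup_{G'\text{ gray option}}\mathcal C_n(G')$; put $\mathcal G_{n+1}(G)=\mathrm{Moon}$ if $\mathbb Z_0^+\subseteq D\cup P$, and $\mathcal G_{n+1}(G)=\mathrm{mex}(D\cup P)$ otherwise. If $x$ is gray and all options of $G=(V,x)$ are assigned, put $\mathcal C_{n+1}(G)=\{k\in\mathbb Z_0^+:\mathrm{Cr}(G,k)=\textsc{true}\}$. All other nodes keep their value. *)

(* Defs.v *)
From HB Require Import structures.
From mathcomp Require Import all_boot all_order all_algebra.
From mathcomp Require Import boolp classical_sets functions cardinality.
Set Implicit Arguments.
Unset Strict Implicit.
Unset Printing Implicit Defensive.

Local Open Scope classical_set_scope.

Record game_graph := GameGraph {
  node :> finType;
  arc : rel node;
  gray : pred node;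
  acyclic : forall c : seq node, cycle arc c -> c = [::]
}.

Arguments arc {g}.
Arguments gray {g}.

Section Graph.
Variable V : game_graph.
Implicit Types x y : V.

Definition terminal x : bool := [forall y, ~~ arc x y].
Definition white_options x : set V := [set y | arc x y && ~~ gray y].
Definition gray_options x : set V := [set y | arc x y && gray y].

Lemma arc_wf : well_founded (fun y x : V => arc x y).
Proof.
have dec x y : arc x y -> (#|connect arc y| < #|connect arc x|)%N.
  move=> xy; apply/proper_card/properP; split.
    by apply/fintype.subsetP => z; apply: connect_trans; exact: connect1.
  exists x; first exact: connect0.
  apply/negP => /connectP[p yp xE].
  have := @acyclic V (y :: p).
  by rewrite /= rcons_path yp -xE xy => /(_ isT).
move=> x; have [m] := ubnP #|connect arc x|.
elim: m x => [x|m IH x xm]; first by rewrite ltn0.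
constructor => y /dec yx; apply: IH.
exact: leq_trans yx xm.
Qed.

End Graph.

Inductive wvalue := Num of nat | Moon.
HB.instance Definition _ := gen_eqMixin wvalue.

(* Only the white component is meaningful at white nodes and only the gray one
   at gray nodes. [None] is the symbol "infinity" (not assigned yet). *)
Record labelling (V : game_graph) := Labelling {
  wlab : V -> option wvalue;
  glab : V -> option (set nat)
}.

Section Labels.
Variable V : game_graph.
Implicit Types (L : labelling V) (x y : V).

Definition assigned L x : bool :=
  if gray x then isSome (glab L x) else isSome (wlab L x).

Definition options_assigned L x : bool :=
  [forall y, arc x y ==> assigned L y].

(* [set0] is a dummy value for nodes that are not assigned. *)
Definition gset L x : set nat := odflt set0 (glab L x).

(* The integer elements of D; Moon plays no role in the union of D and P. *)
Definition white_values L x : set nat :=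
  [set k | exists2 y, white_options x y & wlab L y = Some (Num k)].

Definition gray_union L x : set nat := \bigcup_(y in gray_options x) gset L y.

(* Recursion along the arcs; the subtype [{y | arc x y}] is the type of options
   of [x], and [CrE] below is the recursive equation. *)
Definition Cr L : V -> nat -> bool :=
  Fix (@arc_wf V) (fun=> nat -> bool) (fun x rec k =>
    terminal x ||
    [forall y : {y | arc x y},
       if gray (val y) then ~~ rec (val y) (valP y) k
       else wlab L (val y) != Some (Num k)]).

Lemma CrE L x k :
  Cr L x k = terminal x ||
    [forall y, arc x y ==>
       if gray y then ~~ Cr L y k else wlab L y != Some (Num k)].
Proof.
rewrite /Cr Fix_eq => [|z f g fg].
  congr (_ || _); apply/forallP/forallP => [H y|H [y xy]] /=.
    by apply/implyP => xy; exact: (H (exist _ y xy)).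
  by have /implyP/(_ xy) := H y.
apply/funext => j; congr (_ || _); apply: eq_forallb => y.
by rewrite fg.
Qed.

(* The value [0] for [S = setT] is never used. *)
Definition mex (S : set nat) : nat :=
  if pselect (exists k, `[< ~ S k >]) is left h then ex_minn h else 0.

Definition label0 : labelling V := Labelling
  (fun x => if ~~ gray x && terminal x then Some (Num 0) else None)
  (fun x => if gray x && terminal x then Some [set: nat] else None).

Definition label_step L : labelling V := Labelling
  (fun x => if ~~ gray x && options_assigned L x then
              let S := white_values L x `|` gray_union L x in
              Some (if `[< [set: nat] `<=` S >] then Moon else Num (mex S))
            else wlab L x)
  (fun x => if gray x && options_assigned L x then Some [set k | Cr L x k]
            else glab L x).

Fixpoint label (n : nat) : labelling V :=
  if n is m.+1 then label_step (label m) else label0.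

Lemma glab_succ n x : gray x -> options_assigned (label n) x ->
  glab (label n.+1) x = Some [set k | Cr (label n) x k].
Proof. by move=> gx ax; rewrite /= gx ax. Qed.

Definition infinite_gray_options L x : set V :=
  [set y | gray_options x y /\ infinite_set (gset L y)].

End Labels.

Arguments label {V}.

Definition is_max (A : set nat) (l : int) : Prop :=
  (A = set0 /\ l = (-1)%R) \/
  (exists m : nat, [/\ A m, forall a, A a -> (a <= m)%N & l = Posz m]).

Definition is_least_exceeding (A : set nat) (l : nat) : Prop :=
  (forall a, A a -> (a < l)%N) /\
  (forall m, (forall a, A a -> (a < m)%N) -> (l <= m)%N).

(* Main.v *)
Require Import Defs.
From mathcomp Require Import all_boot all_order all_algebra.
From mathcomp Require Import boolp classical_sets functions cardinality.
Local Open Scope classical_set_scope.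

(** Labels never change once they are assigned, and a node is assigned only
    after its options, so [Cr] computed at step [n] agrees with the label of
    every assigned gray node. The recursion for [Cr] at [x] then says that
    [C_(n+1)(G)] is the complement of the union of the labels of the options of
    [x]. If one of these is cofinite, the complement is finite; if all of them
    are finite, it is cofinite; the dichotomy follows by induction along the
    arcs. *)

(** * Bounds and maxima of finite sets of naturals *)

Lemma finite_set_nat_bounded (A : set nat) :
  finite_set A -> exists l, forall a, A a -> a < l.
Proof.
move=> /finite_seqP[s ->]; exists (\max_(i <- s) i).+1 => a /= sa.
by rewrite ltnS; exact: leq_bigmax_seq.
Qed.

Lemma finite_set_is_least_exceeding (A : set nat) :
  finite_set A -> exists l, is_least_exceeding A l.
Proof.
move=> /finite_set_nat_bounded[b Ab].
pose P l := `[< forall a, A a -> a < l >].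
have exP : exists l, P l by exists b; apply/asboolP.
case: (ex_minnP exP) => l /asboolP Al lmin; exists l; split=> // m Am.
by apply: lmin; apply/asboolP.
Qed.

(** The maximum is the predecessor of the least strict upper bound; that bound is 0 exactly when [A]
    is empty, which matches the convention -1. *)
Lemma finite_set_is_max (A : set nat) :
  finite_set A -> exists l, is_max A l.
Proof.
move=> /finite_set_is_least_exceeding[[|m] [Am lmin]].
  exists (-1)%R; left; split=> //.
  by rewrite -subset0 => a /Am.
exists (Posz m); right; exists m; split=> //.
(* If [m] were not in [A], then [m] would already be a strict bound, against the minimality of
   [m.+1]. *)
apply: contrapT => nAm; suff : m < m by rewrite ltnn.
by apply: lmin => a Aa; rewrite ltn_neqAle -ltnS (Am _ Aa) andbT;
  apply/eqP => am; apply: nAm; rewrite -am.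
Qed.

Lemma is_max_lt (A : set nat) (l : int) (k : nat) :
  is_max A l -> (l < Posz k)%R -> ~ A k.
Proof.
move=> [[-> _ _ []]|[m [_ Am ->]]].
by rewrite ltz_nat ltnNge => /negP mk /Am.
Qed.

Section Labels.
Context {V : game_graph}.
Implicit Types (L : labelling V) (x y : V).

(** * Persistence of labels *)

Lemma options_assignedP L x :
  reflect (forall y, Defs.arc x y -> assigned L y) (options_assigned L x).
Proof.
by apply: (iffP forallP) => H y; [move=> xy; exact: (implyP (H y))|
  apply/implyP => xy; exact: H].
Qed.

Definition extends L L' : Prop :=
  (forall x v, wlab L x = Some v -> wlab L' x = Some v) /\
  (forall x S, glab L x = Some S -> glab L' x = Some S).

(** This invariant lets inductions along the arcs pass from an assigned node to its options. *)
Definition option_closed L : Prop :=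
  (forall x v, wlab L x = Some v -> options_assigned L x) /\
  (forall x S, glab L x = Some S -> options_assigned L x).

Lemma option_closed_assigned L x :
  option_closed L -> assigned L x -> options_assigned L x.
Proof.
move=> [cw cg]; rewrite /assigned; case: ifP => _.
  by case E: (glab L x) => [S|//] _; exact: cg E.
by case E: (wlab L x) => [v|//] _; exact: cw E.
Qed.

Lemma extends_wlab L L' x :
  extends L L' -> assigned L x -> ~~ gray x -> wlab L' x = wlab L x.
Proof.
move=> [ew _]; rewrite /assigned => + /negPf gx; rewrite gx.
by case E: (wlab L x) => [v|//] _; rewrite (ew _ _ E).
Qed.

Lemma extends_glab L L' x :
  extends L L' -> assigned L x -> gray x -> glab L' x = glab L x.
Proof.
move=> [_ eg]; rewrite /assigned => + gx; rewrite gx.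
by case E: (glab L x) => [S|//] _; rewrite (eg _ _ E).
Qed.

Lemma extends_assigned L L' x : extends L L' -> assigned L x -> assigned L' x.
Proof.
move=> e ax; move: (ax); rewrite /assigned; case: ifPn => gx.
  by rewrite (extends_glab _ _ _ e).
by rewrite (extends_wlab _ _ _ e).
Qed.

Lemma extends_options_assigned L L' x :
  extends L L' -> options_assigned L x -> options_assigned L' x.
Proof.
move=> e /options_assignedP ax; apply/options_assignedP => y /ax.
exact: extends_assigned.
Qed.

Lemma extends_white_values L L' x : extends L L' -> options_assigned L x ->
  white_values L' x = white_values L x.
Proof.
move=> e /options_assignedP ax; apply/seteqP.
by split=> k [y /[dup] xy /andP[axy gy] yk]; exists y => //; move: yk;
  rewrite (extends_wlab _ _ _ e (ax _ axy) gy).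
Qed.

Lemma extends_gray_union L L' x : extends L L' -> options_assigned L x ->
  gray_union L' x = gray_union L x.
Proof.
move=> e /options_assignedP ax; apply: eq_bigcupr => y /= /andP[xy gy].
by rewrite /gset (extends_glab _ _ _ e (ax _ xy) gy).
Qed.

(** [Cr] consults [wlab] only at white options reached through gray nodes. By [option_closed] all of
    these are assigned in [L], so [L'] shows the same values there. *)
Lemma extends_Cr L L' x : extends L L' -> option_closed L ->
  options_assigned L x -> Cr L' x = Cr L x.
Proof.
move=> e c; elim: x / (@arc_wf V x) => x _ IH ax; apply/funext => k.
rewrite !CrE; congr (_ || _); apply: eq_forallb => y.
case xy: (Defs.arc x y) => //=; have ay := options_assignedP _ _ ax y xy.
case: ifPn => gy; last by rewrite (extends_wlab _ _ _ e ay gy).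
by rewrite IH //; exact: option_closed_assigned.
Qed.

Lemma option_closed_label0 : option_closed (@label0 V).
Proof.
by split=> x v /=; case: ifP => // /andP[_ /forallP tx] _;
  apply/options_assignedP => y xy; case/negP: (tx y).
Qed.

(** A terminal node has vacuously assigned options, so the first step recomputes its label. The
    union of [D] and [P] is empty there, so a white node gets [mex] of the empty set, again 0, and a
    gray one all integers. *)
Lemma extends_label0 : extends (@label0 V) (label_step (@label0 V)).
Proof.
have E x : terminal x ->
    white_values (@label0 V) x `|` gray_union (@label0 V) x = set0.
  move=> /forallP tx; rewrite -subset0 => k.
  by case=> [[y /andP[xy _] _]|[y /andP[xy _] _]]; case/negP: (tx y).
split=> x v /=; case: ifP => // /andP[gx tx] <-.
  rewrite gx E // ifT.
    congr (Some _); case: asboolP => [/(_ 0 I)//|_].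
    rewrite /mex; case: pselect => [h|[]]; last first.
      by exists 0; apply/asboolP.
    by case: ex_minnP => m _ /(_ 0); rewrite leqn0 => /(_ _)/eqP-> //;
      apply/asboolP.
  by apply/options_assignedP => y xy; case/negP: (forallP tx y).
rewrite gx ifT; last first.
  by apply/options_assignedP => y xy; case/negP: (forallP tx y).
by congr (Some _); apply/seteqP; split=> // k _ /=; rewrite CrE tx.
Qed.

Lemma option_closed_step L : extends L (label_step L) -> option_closed L ->
  option_closed (label_step L).
Proof.
move=> e [cw cg]; split=> x v /=.
  by case: ifP => [/andP[_ ax] _|_ /cw ax]; exact: extends_options_assigned ax.
by case: ifP => [/andP[_ ax] _|_ /cg ax]; exact: extends_options_assigned ax.
Qed.

(** A step recomputes labels that exist already; the result is the same because everything it is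
    computed from was assigned in [L] and has persisted. *)
Lemma extends_step L : extends L (label_step L) -> option_closed L ->
  extends (label_step L) (label_step (label_step L)).
Proof.
move=> e c; have [cw cg] := c.
have ext := extends_options_assigned _ _ _ e.
split=> x v.
  rewrite [wlab (label_step L) x]/= [wlab (label_step _) x]/=.
  case: ifP => [/andP[gx ax] <-|nax xv].
    by rewrite gx ext // (extends_white_values _ _ _ e) //
       (extends_gray_union _ _ _ e).
  (* A white node with a label kept from [L] has its options assigned in [L], so the first of the
     two steps would have recomputed it, against [nax]. *)
  by case: ifP => // /andP[gx _]; rewrite gx (cw _ _ xv) in nax.
rewrite [glab (label_step L) x]/= [glab (label_step _) x]/=.
case: ifP => [/andP[gx ax] <-|nax xv].
  by rewrite gx ext // (extends_Cr _ _ _ e).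
by case: ifP => // /andP[gx _]; rewrite gx (cg _ _ xv) in nax.
Qed.

(** The two invariants are proved together, since the induction step for each uses both. *)
Lemma label_invariants n :
  extends (label (V := V) n) (label n.+1) /\ option_closed (label (V := V) n).
Proof.
elim: n => [|n [e c]].
  by split; [exact: extends_label0|exact: option_closed_label0].
by split; [exact: extends_step|exact: option_closed_step].
Qed.

(** * Gray labels as complements, and their finiteness *)

Lemma gset_label n x : gray x -> assigned (label n) x ->
  gset (label n) x = [set k | Cr (label n) x k].
Proof.
move=> gx ax; have [e c] := label_invariants n.
(* The step at which [x] got its label need not be known: step [n.+1] recomputes it from
   [Cr (label n)], and by [e] this changes nothing. *)
rewrite /gset -(extends_glab _ _ _ e) // glab_succ //.
exact: option_closed_assigned.
Qed.

Lemma Cr_label_setC n x : options_assigned (label n) x ->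
  [set k | Cr (label n) x k] =
  ~` (gray_union (label n) x `|` white_values (label n) x).
Proof.
move=> /options_assignedP ax; apply/seteqP; split=> k /=; rewrite CrE.
  case/orP=> [/forallP tx|/forallP H].
    by case=> [[y /andP[xy _] _]|[y /andP[xy _] _]]; case/negP: (tx y).
  case=> [[y /andP[xy gy]]|[y /andP[xy gy] yk]]; have := H y; rewrite xy /=.
    by rewrite gset_label ?gy //; [move=> /negP|exact: ax].
  by rewrite (negPf gy) yk eqxx.
move=> H; apply/orP; right; apply/forallP => y; apply/implyP => xy.
case: ifPn => gy.
  apply/negP => yk; apply: H; left; exists y; first exact/andP.
  by rewrite gset_label //; exact: ax.
by apply/eqP => yk; apply: H; right; exists y => //; exact/andP.
Qed.

Lemma finite_white_values L x : finite_set (white_values L x).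
Proof.
(* The default 0 for [Moon] and for unassigned nodes is harmless, since only an inclusion is
   needed. *)
apply: (@sub_finite_set _ _
  ((fun y => if wlab L y is Some (Defs.Num k) then k else 0) @` [set: V])).
  by move=> k [y _ yk]; exists y; rewrite //= yk.
by apply: finite_image; exact: finite_finset.
Qed.

Lemma finite_gray_union L x : ~ (infinite_gray_options L x !=set0) ->
  finite_set (gray_union L x).
Proof.
move=> H; apply: bigcup_finite => [|y xy]; first exact: finite_finset.
by apply: contrapT => ny; apply: H; exists y; split.
Qed.

Lemma finite_or_cofinite_Cr n x : options_assigned (label n) x ->
  finite_set [set k | Cr (label n) x k] \/
  finite_set (~` [set k | Cr (label n) x k]).
Proof.
elim: x / (@arc_wf V x) => x _ IH ax.
have [[y [/= xy iy]]|ng] := pselect (infinite_gray_options (label n) x !=set0).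
  left; move: (xy) => /andP[axy gy].
  have ay := options_assignedP _ _ ax y axy.
  have [_ c] := label_invariants n.
  (* The finite alternative for [y] contradicts [iy]. In the other one, the set at [x] lies in the
     finite complement of the label of [y]. *)
  have [|fy] := IH y axy (option_closed_assigned _ _ c ay).
    by rewrite -gset_label.
  apply: sub_finite_set fy; rewrite Cr_label_setC // -gset_label //.
  by apply: subsetC => k yk; left; exists y.
right; rewrite Cr_label_setC // setCK finite_setU; split.
  exact: finite_gray_union.
exact: finite_white_values.
Qed.

End Labels.

Theorem theorem1p14 (V : game_graph) (n : nat) (x : V) :
  gray x ->
  options_assigned (label n) x ->
  let C : set nat := [set k | Cr (label n) x k] in
  [/\ finite_set C \/
        (infinite_set C /\ exists2 F : set nat, finite_set F & C = ~` F),
      infinite_gray_options (label n) x !=set0 ->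
        (forall y, infinite_gray_options (label n) x y ->
           finite_set (~` gset (label n) y)) /\
        (exists l : int,
           is_max (\bigcup_(y in infinite_gray_options (label n) x)
                     ~` gset (label n) y) l /\
           forall k : nat, (l < Posz k)%R -> Cr (label n) x k = false) &
      ~ (infinite_gray_options (label n) x !=set0) ->
        exists l : nat,
          is_least_exceeding
            (gray_union (label n) x `|` white_values (label n) x) l /\
          forall k : nat, (l <= k)%N -> Cr (label n) x k = true].
Proof.
move=> _ ax C; have CE := Cr_label_setC _ _ ax; split.
- have [?|fC] := finite_or_cofinite_Cr _ _ ax; first by left.
  (* Deciding finiteness of [C] classically supplies the infinitude of [C] required beside its
     cofiniteness. *)
  have [?|iC] := pselect (finite_set C); [by left|right; split=> //].
  by exists (~` C); rewrite ?setCK.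
- move=> [y0 iy0].
  have cofin y : infinite_gray_options (label n) x y ->
      finite_set (~` gset (label n) y).
    move=> [/andP[xy gy]].
    have ay := options_assignedP _ _ ax y xy.
    have [_ c] := @label_invariants V n.
    rewrite gset_label // => iy.
    by have [|] := finite_or_cofinite_Cr _ _ (option_closed_assigned _ _ c ay).
  split=> //.
  have /finite_set_is_max[l lmax] :
      finite_set (\bigcup_(y in infinite_gray_options (label n) x)
                     ~` gset (label n) y).
    by apply: bigcup_finite cofin; exact: finite_finset.
  exists l; split=> // k /(is_max_lt _ _ _ lmax) nk.
  apply/negP; rewrite -[is_true _]/([set k | Cr (label n) x k] k) CE; apply.
  (* Any infinite gray option serves: [k] exceeds [l], so it avoids the complement of the label of
     [y0] and lies in that label, hence outside the set at [x]. *)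
  left; exists y0; first by case: iy0.
  by apply: contrapT => ky0; apply: nk; exists y0.
- move=> ng.
  have /finite_set_is_least_exceeding[l lE] :
      finite_set (gray_union (label n) x `|` white_values (label n) x).
    by rewrite finite_setU; split;
      [exact: finite_gray_union|exact: finite_white_values].
  exists l; split=> // k lk.
  suff : [set k | Cr (label n) x k] k by [].
  (* By [CE] the goal is a negation: a [k] in the union would lie below [l]. *)
  rewrite CE => /(proj1 lE).
  by rewrite ltnNge lk.
Qed.
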